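(* In the axiomatic system Zermelo, $Z$ (without any version of the Axiom of Choice, and without Replacement and Foundation), the following is provable: for every set $X$, the following three conditions are equivalent to each other: (1) $X$ is Cardinal Infinite, i.e. $card(X) \geq \aleph_0$; (2) $X$ is Cantor Infinite; (3) $X$ is Dedekind Infinite.
   Context: The system $Z$ is the first-order theory with equality and one binary predicate $\in$ (all objects are sets, no atoms), with the axioms: Extensionality; Null Set (existence of $\emptyset$); Pair Set; Union Set; Infinity (there is an inductive set: a set containing $\emptyset$ and closed under $a \mapsto a \cup \{a\}$); Power Set; and the axiom schema of restricted Comprehension (for every set $a$ and every formula $\varphi(x,u_1,\dots,u_n)$ with parameters $u_i$, the set $\{x \in a : \varphi(x,u_1,\dots,u_n)\}$ exists). The axioms of Replacement, Foundation and Choice are not included in $Z$. Here $\omega = \mathbb{N}$ is the least inductive set. Two sets are equipotent if there is a bijection between them. A set is countable if it is equipotent to $\omega$. A set $X$ is: - Cardinal Infinite if $card(X) \geq \aleph_0$, i.e. there is an injection $\omega \to X$; - Cantor Infinite if it contains a countable subset (a subset equipotent to $\omega$); - Dedekind Infinite if it contains a proper subset $B \subset X$ equipotent to $X$. *)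

(* Defs.v *)
From Stdlib Require Import List.
Import ListNotations.

(** ** First-order logic with equality and one binary predicate *)

(** Variables are de Bruijn indices: [fAll A] binds index [0] of [A], and index
    [S n] in [A] refers to variable [n] of [fAll A]. The language has no function
    symbols, so variables are the only terms and renaming is the only substitution. *)
Inductive form : Type :=
| fBot : form
| fMem : nat -> nat -> form
| fEq : nat -> nat -> form
| fImp : form -> form -> form
| fAll : form -> form.

(** The logic is classical, so the other connectives are abbreviations. *)
Definition fNot (A : form) : form := fImp A fBot.
Definition fAnd (A B : form) : form := fNot (fImp A (fNot B)).
Definition fOr (A B : form) : form := fImp (fNot A) B.
Definition fIff (A B : form) : form := fAnd (fImp A B) (fImp B A).
Definition fEx (A : form) : form := fNot (fAll (fNot A)).

Declare Scope fol_scope.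
Delimit Scope fol_scope with fol.
Bind Scope fol_scope with form.
Notation "x ∈ y" := (fMem x y) (at level 70, no associativity) : fol_scope.
Notation "x ≡ y" := (fEq x y) (at level 70, no associativity) : fol_scope.
Notation "∼ A" := (fNot A) (at level 75, right associativity) : fol_scope.
Notation "A ⋀ B" := (fAnd A B) (at level 80, right associativity) : fol_scope.
Notation "A ⋁ B" := (fOr A B) (at level 85, right associativity) : fol_scope.
Notation "A ⟶ B" := (fImp A B) (at level 90, right associativity) : fol_scope.
Notation "A ⟷ B" := (fIff A B) (at level 95, no associativity) : fol_scope.
Local Open Scope fol_scope.

(** The renaming that acts as [r] on the outer variables and fixes the one just
    bound. *)
Definition up (r : nat -> nat) (n : nat) : nat :=
  match n with 0 => 0 | S n => S (r n) end.

Fixpoint rename (r : nat -> nat) (A : form) : form :=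
  match A with
  | fBot => fBot
  | fMem x y => fMem (r x) (r y)
  | fEq x y => fEq (r x) (r y)
  | fImp A B => fImp (rename r A) (rename r B)
  | fAll A => fAll (rename (up r) A)
  end.

(** [inst t A] is the body [A] of a quantifier with the bound variable replaced
    by [t]. *)
Definition inst (t : nat) : form -> form :=
  rename (fun n => match n with 0 => t | S n => n end).

(** All free variables of [A] are among [0, ..., n - 1]. *)
Fixpoint bounded (n : nat) (A : form) : Prop :=
  match A with
  | fBot => True
  | fMem x y | fEq x y => x < n /\ y < n
  | fImp A B => bounded n A /\ bounded n B
  | fAll A => bounded (S n) A
  end.

Fixpoint fAlls (n : nat) (A : form) : form :=
  match n with 0 => A | S n => fAlls n (fAll A) end.

(** Classical natural deduction. *)
Inductive deriv : list form -> form -> Prop :=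
| d_ax G A : In A G -> deriv G A
| d_impI G A B : deriv (A :: G) B -> deriv G (A ⟶ B)
| d_impE G A B : deriv G (A ⟶ B) -> deriv G A -> deriv G B
| d_allI G A : deriv (map (rename S) G) A -> deriv G (fAll A)
| d_allE G A t : deriv G (fAll A) -> deriv G (inst t A)
| d_raa G A : deriv ((∼ A) :: G) fBot -> deriv G A
| d_refl G x : deriv G (x ≡ x)
| d_leibniz G A x y : deriv G (x ≡ y) -> deriv G (inst x A) -> deriv G (inst y A).

Definition provable (T : form -> Prop) (A : form) : Prop :=
  exists G : list form, (forall B, In B G -> T B) /\ deriv G A.

(** ** Set-theoretic vocabulary

    The arguments of the abbreviations below are variables; under [k] further
    quantifiers an argument [x] becomes [k + x]. *)

Definition is_empty (x : nat) : form := fAll (∼ 0 ∈ 1 + x).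

Definition is_subset (x y : nat) : form := fAll (0 ∈ 1 + x ⟶ 0 ∈ 1 + y).

(** [c = {a, b}] *)
Definition is_pair (c a b : nat) : form :=
  fAll (0 ∈ 1 + c ⟷ 0 ≡ 1 + a ⋁ 0 ≡ 1 + b).

(** [p = (a, b)], where [(a, b) = {{a}, {a, b}}] *)
Definition is_opair (p a b : nat) : form :=
  fAll (0 ∈ 1 + p ⟷ is_pair 0 (1 + a) (1 + a) ⋁ is_pair 0 (1 + a) (1 + b)).

(** [(a, b) ∈ f] *)
Definition opair_in (a b f : nat) : form :=
  fEx (is_opair 0 (1 + a) (1 + b) ⋀ 0 ∈ 1 + f).

(** [s = a ∪ {a}] *)
Definition is_succ (s a : nat) : form :=
  fAll (0 ∈ 1 + s ⟷ 0 ∈ 1 + a ⋁ 0 ≡ 1 + a).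

Definition is_inductive (w : nat) : form :=
  fEx (is_empty 0 ⋀ 0 ∈ 1 + w) ⋀
  fAll (0 ∈ 1 + w ⟶ fEx (is_succ 0 1 ⋀ 0 ∈ 2 + w)).

Definition is_omega (w : nat) : form :=
  is_inductive w ⋀ fAll (is_inductive 0 ⟶ is_subset (1 + w) 0).

(** [f] is a function from [x] to [y]: a subset of [x × y] that is total on [x]
    and single-valued. *)
Definition is_function (f x y : nat) : form :=
  fAll (0 ∈ 1 + f ⟶ fEx (fEx (1 ∈ 3 + x ⋀ 0 ∈ 3 + y ⋀ is_opair 2 1 0))) ⋀
  fAll (0 ∈ 1 + x ⟶ fEx (opair_in 1 0 (2 + f))) ⋀
  fAll (fAll (fAll (opair_in 2 1 (3 + f) ⋀ opair_in 2 0 (3 + f) ⟶ 1 ≡ 0))).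

Definition is_injection (f x y : nat) : form :=
  is_function f x y ⋀
  fAll (fAll (fAll (opair_in 2 0 (3 + f) ⋀ opair_in 1 0 (3 + f) ⟶ 2 ≡ 1))).

Definition is_bijection (f x y : nat) : form :=
  is_injection f x y ⋀
  fAll (0 ∈ 1 + y ⟶ fEx (opair_in 0 1 (2 + f))).

Definition equipotent (x y : nat) : form := fEx (is_bijection 0 (1 + x) (1 + y)).

Definition countable (x : nat) : form := fEx (is_omega 0 ⋀ equipotent (1 + x) 0).

Definition cardinal_infinite (x : nat) : form :=
  fEx (is_omega 0 ⋀ fEx (is_injection 0 1 (2 + x))).

Definition cantor_infinite (x : nat) : form :=
  fEx (is_subset 0 (1 + x) ⋀ countable 0).

Definition dedekind_infinite (x : nat) : form :=
  fEx (is_subset 0 (1 + x) ⋀ (∼ 0 ≡ 1 + x) ⋀ equipotent 0 (1 + x)).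

(** ** The theory Z *)

Definition ax_extensionality : form :=
  fAll (fAll (fAll (0 ∈ 2 ⟷ 0 ∈ 1) ⟶ 1 ≡ 0)).

Definition ax_null : form := fEx (is_empty 0).

Definition ax_pair : form := fAll (fAll (fEx (is_pair 0 2 1))).

Definition ax_union : form :=
  fAll (fEx (fAll (0 ∈ 1 ⟷ fEx (0 ∈ 3 ⋀ 1 ∈ 0)))).

Definition ax_infinity : form := fEx (is_inductive 0).

Definition ax_power : form := fAll (fEx (fAll (0 ∈ 1 ⟷ is_subset 0 2))).

(** In [A] the variable [0] stands for [x] and [1, ..., n] for the parameters;
    inside the three quantifiers over [a], [b] and [x] the parameters start at
    index [3]. *)
Definition ax_comprehension (n : nat) (A : form) : form :=
  fAlls n (fAll (fEx (fAll
    (0 ∈ 1 ⟷ 0 ∈ 2 ⋀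
       rename (fun k => match k with 0 => 0 | S i => 3 + i end) A)))).

Inductive Z : form -> Prop :=
| Z_extensionality : Z ax_extensionality
| Z_null : Z ax_null
| Z_pair : Z ax_pair
| Z_union : Z ax_union
| Z_infinity : Z ax_infinity
| Z_power : Z ax_power
| Z_comprehension n A : bounded (S n) A -> Z (ax_comprehension n A).

(* Main.v *)
From Stdlib Require Import List Lia Cantor Classical.
From Stdlib Require Import FunctionalExtensionality PropExtensionality ProofIrrelevance.
Require Import Defs.
Import ListNotations.

(** The theorem asserts the existence of a formal derivation, but the derivation need not be
    written down. By the completeness theorem for classical first-order logic with equality
    ([completeness]) it suffices that the sentence holds in every structure [(D, E)] that
    satisfies Z, and in such a structure the proof is ordinary mathematics.

    Completeness is Henkin's. A consistent set of sentences leaves infinitely many variables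
    free to serve as witnesses, so it extends to a complete theory in which every false
    [fAll C] has a false instance ([henkin_all]). The variables modulo provable equality then
    form a model ([model_existence]).

    Inside a model of Z, [D] may be nonstandard: the natural numbers of the model are the
    elements of its least inductive set [w], and both comprehension and induction on [w] hold
    only for predicates defined by formulas with parameters. [Definable] records this
    restriction, and [separation], [relation_ex] and [omega_ind] are the three forms in
    which definability is used.

    - Cardinal infinite implies Cantor infinite: the range of an injection [w -> x] exists by
      comprehension, and the inverse of a bijection is again a set. The same inversion gives
      the converse.
    - Cardinal infinite implies Dedekind infinite: given an injection [f : w -> x], shifting
      [f (n + 1)] to [f n] and fixing what lies outside the range of [f] is a bijection
      from [x] without [f 0] onto [x].
    - Dedekind infinite implies Cardinal infinite: if [h] is a bijection from a proper subset
      [y] of [x] onto [x] and [x0] is in [x] but not in [y], then iterating the inverse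
      of [h] from [x0] never repeats a value. Lacking Replacement, the sequence is obtained as
      the least subset of the product of [w] and [x] that contains [(0, x0)] and is closed
      under the step. *)

#[local] Opaque to_nat of_nat.

(** * Renaming of variables *)

Definition scons {D : Type} (d : D) (e : nat -> D) (n : nat) : D :=
  match n with 0 => d | S n => e n end.
Local Notation "d .: e" := (scons d e) (at level 55, right associativity).

Lemma rename_ext A : forall r s, (forall n, r n = s n) -> rename r A = rename s A.
Proof.
  induction A as [|x y|x y|A IHA B IHB|A IHA]; intros r s H; cbn;
    try (f_equal; auto; fail).
  f_equal; apply IHA; intros [|n]; cbn; auto.
Qed.

Lemma rename_rename A : forall r s, rename r (rename s A) = rename (fun n => r (s n)) A.
Proof.
  induction A as [|x y|x y|A IHA B IHB|A IHA]; intros r s; cbn; auto.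
  - now rewrite IHA, IHB.
  - rewrite IHA; f_equal; apply rename_ext; intros [|n]; reflexivity.
Qed.

Lemma bounded_rename_ext A : forall n r s,
  bounded n A -> (forall k, k < n -> r k = s k) -> rename r A = rename s A.
Proof.
  induction A as [|x y|x y|A IHA B IHB|A IHA]; intros n r s HA H; cbn in *.
  - reflexivity.
  - now f_equal; apply H.
  - now f_equal; apply H.
  - destruct HA; f_equal; eauto.
  - f_equal; apply (IHA (S n)); auto.
    intros [|k] Hk; cbn; auto. f_equal; apply H; lia.
Qed.

Lemma rename_id A : rename (fun n => n) A = A.
Proof.
  induction A as [|x y|x y|A IHA B IHB|A IHA]; cbn; auto.
  - now rewrite IHA, IHB.
  - rewrite <- IHA at 2; f_equal; apply rename_ext; intros [|n]; reflexivity.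
Qed.

Lemma bounded_rename A : forall n m r,
  bounded n A -> (forall k, k < n -> r k < m) -> bounded m (rename r A).
Proof.
  induction A as [|x y|x y|A IHA B IHB|A IHA]; intros n m r HA H; cbn in *; auto.
  - destruct HA; auto.
  - destruct HA; auto.
  - destruct HA; eauto.
  - apply (IHA (S n)); auto. intros [|k] Hk; cbn; [lia|].
    enough (r k < m) by lia. apply H; lia.
Qed.

Lemma bounded_le A n m : bounded n A -> n <= m -> bounded m A.
Proof.
  intros H Hle. rewrite <- (rename_id A).
  apply (bounded_rename A n); auto. intros; lia.
Qed.

Lemma inst_up r t A : rename r (inst t A) = inst (r t) (rename (up r) A).
Proof.
  unfold inst. rewrite !rename_rename. apply rename_ext. now intros [|n].
Qed.

Lemma bounded_fAlls n : forall m A, bounded (n + m) A -> bounded m (fAlls n A).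
Proof.
  induction n as [|n IH]; intros m A H; cbn; auto.
Qed.

(** * Derivations *)

Lemma deriv_weaken G A : deriv G A -> forall H, incl G H -> deriv H A.
Proof.
  induction 1; intros K HK.
  - apply d_ax; auto.
  - apply d_impI, IHderiv. intros C [<-|HC]; cbn; auto.
  - eapply d_impE; eauto.
  - apply d_allI, IHderiv. now apply incl_map.
  - apply d_allE; auto.
  - apply d_raa, IHderiv. intros C [<-|HC]; cbn; auto.
  - apply d_refl.
  - eapply d_leibniz; eauto.
Qed.

Lemma deriv_rename G A : deriv G A -> forall r, deriv (map (rename r) G) (rename r A).
Proof.
  induction 1; intros r; cbn.
  - apply d_ax. now apply in_map.
  - apply d_impI. apply IHderiv.
  - eapply d_impE; [apply IHderiv1 | apply IHderiv2].
  - apply d_allI. specialize (IHderiv (up r)).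
    rewrite map_map in *. erewrite map_ext; [exact IHderiv|].
    intros B; cbn. rewrite !rename_rename. reflexivity.
  - rewrite inst_up. apply d_allE, IHderiv.
  - apply d_raa. apply IHderiv.
  - apply d_refl.
  - rewrite inst_up in *. eapply d_leibniz; [apply IHderiv1|].
    rewrite <- inst_up. apply IHderiv2.
Qed.

(** Generalization on a fresh variable [x]. The rule for quantifiers shifts the whole context;
    the renaming that sends [x] to [0] and shifts everything else agrees with the shift on the
    context, where [x] does not occur, and turns the instance of [A] at [x] back into [A]. *)
Lemma deriv_generalize G A x :
  (forall B, In B G -> bounded x B) -> bounded (S x) A ->
  deriv G (inst x A) -> deriv G (fAll A).
Proof.
  intros HG HA H. apply d_allI.
  apply (deriv_rename _ _) with (r := fun n => if Nat.eqb n x then 0 else S n) in H.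
  replace (map (rename S) G)
    with (map (rename (fun n => if Nat.eqb n x then 0 else S n)) G).
  2:{ apply map_ext_in. intros B HB. apply (bounded_rename_ext B x); auto.
      intros k Hk. destruct (PeanoNat.Nat.eqb_spec k x); lia. }
  unfold inst in H. rewrite rename_rename in H.
  rewrite <- (rename_id A).
  erewrite (bounded_rename_ext A (S x)); [exact H|exact HA|].
  intros [|k] Hk; cbn.
  - now rewrite PeanoNat.Nat.eqb_refl.
  - destruct (PeanoNat.Nat.eqb_spec k x); lia.
Qed.

Definition add (A : form) (T : form -> Prop) : form -> Prop := fun B => B = A \/ T B.
Definition consistent (T : form -> Prop) : Prop := ~ provable T fBot.

Lemma provable_mono (T U : form -> Prop) A :
  (forall B, T B -> U B) -> provable T A -> provable U A.
Proof. intros H (G & HG & HA). exists G; auto. Qed.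

Lemma provable_ax (T : form -> Prop) A : T A -> provable T A.
Proof.
  intros H. exists [A]. split; [|apply d_ax; cbn; auto].
  now intros B [<-|[]].
Qed.

Lemma add_context A (T : form -> Prop) G :
  (forall B, In B G -> add A T B) ->
  exists G', incl G (A :: G') /\ forall B, In B G' -> T B.
Proof.
  induction G as [|B G IH]; intros H.
  - exists []. split; [intros ? [] | intros ? []].
  - destruct IH as (G' & H1 & H2); [intros; apply H; cbn; auto|].
    destruct (H B) as [->|HB]; cbn; auto.
    + exists G'. split; auto. intros C [<-|HC]; [now left|now apply H1].
    + exists (B :: G'). split.
      * intros C [<-|HC]; cbn; auto. apply H1 in HC as [|]; auto.
      * intros C [<-|HC]; auto.
Qed.

Lemma provable_impI T A B : provable (add A T) B -> provable T (fImp A B).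
Proof.
  intros (G & HG & H). apply add_context in HG as (G' & H1 & H2).
  exists G'. split; auto. apply d_impI. eapply deriv_weaken; eauto.
Qed.

Lemma provable_raa T A : provable (add (fNot A) T) fBot -> provable T A.
Proof.
  intros (G & HG & H). apply add_context in HG as (G' & H1 & H2).
  exists G'. split; auto. apply d_raa. eapply deriv_weaken; eauto.
Qed.

Lemma provable_impE T A B : provable T (fImp A B) -> provable T A -> provable T B.
Proof.
  intros (G & HG & H) (G' & HG' & H'). exists (G ++ G'). split.
  - intros C HC. apply in_app_or in HC as [|]; auto.
  - eapply d_impE; eapply deriv_weaken; eauto using incl_appl, incl_appr, incl_refl.
Qed.

Lemma provable_allE T A t : provable T (fAll A) -> provable T (inst t A).
Proof. intros (G & HG & H). exists G. split; auto. now apply d_allE. Qed.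

Lemma provable_leibniz T A x y :
  provable T (fEq x y) -> provable T (inst x A) -> provable T (inst y A).
Proof.
  intros (G & HG & H) (G' & HG' & H'). exists (G ++ G'). split.
  - intros C HC. apply in_app_or in HC as [|]; auto.
  - eapply d_leibniz; eapply deriv_weaken; eauto using incl_appl, incl_appr, incl_refl.
Qed.

Lemma provable_generalize T A x :
  (forall B, T B -> bounded x B) -> bounded (S x) A ->
  provable T (inst x A) -> provable T (fAll A).
Proof.
  intros HT HA (G & HG & H). exists G. split; auto.
  apply (deriv_generalize G A x); auto.
Qed.

(** * The Henkin extension of a consistent theory *)

(** The pairing function dominates its arguments, so a formula of code [n] only mentions
    variables up to [n] ([bounded_code]). This is what makes variable [S n] fresh below. *)
Fixpoint code (A : form) : nat :=
  match A with
  | fBot => to_nat (0, 0)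
  | fMem x y => to_nat (1, to_nat (x, y))
  | fEq x y => to_nat (2, to_nat (x, y))
  | fImp A B => to_nat (3, to_nat (code A, code B))
  | fAll A => to_nat (4, code A)
  end.

Lemma to_nat_inj p q : to_nat p = to_nat q -> p = q.
Proof.
  intros H. rewrite <- (cancel_of_to p), <- (cancel_of_to q). now rewrite H.
Qed.

Lemma code_inj A : forall B, code A = code B -> A = B.
Proof.
  induction A as [|x y|x y|A IHA B IHB|A IHA]; intros [|u v|u v|C C'|C]; unfold code;
    fold code; intros H; apply to_nat_inj in H; try discriminate; auto.
  - injection H as H. apply to_nat_inj in H. congruence.
  - injection H as H. apply to_nat_inj in H. congruence.
  - injection H as H. apply to_nat_inj in H. injection H as H1 H2.
    f_equal; auto.
  - injection H as H. f_equal; auto.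
Qed.

Lemma bounded_code A : bounded (S (code A)) A.
Proof.
  induction A as [|x y|x y|A IHA B IHB|A IHA]; unfold bounded, code; fold code; fold bounded.
  - trivial.
  - pose proof (to_nat_non_decreasing 1 (to_nat (x, y))).
    pose proof (to_nat_non_decreasing x y). lia.
  - pose proof (to_nat_non_decreasing 2 (to_nat (x, y))).
    pose proof (to_nat_non_decreasing x y). lia.
  - pose proof (to_nat_non_decreasing 3 (to_nat (code A, code B))).
    pose proof (to_nat_non_decreasing (code A) (code B)).
    split; eapply bounded_le; eauto; lia.
  - pose proof (to_nat_non_decreasing 4 (code A)).
    eapply bounded_le; eauto; lia.
Qed.

(** Stage [S n] decides the formula [A] of code [n], which is unique if it exists. [A] is
    added if that is consistent; otherwise [A] is refutable, and if it is a universal formula,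
    a counterexample is named by variable [S n]. By [stage_bounded] no earlier stage
    mentions this variable. *)
Fixpoint stage (T : form -> Prop) (n : nat) : form -> Prop :=
  match n with
  | 0 => T
  | S n => fun B =>
      stage T n B \/
      exists A, code A = n /\
        ((consistent (add A (stage T n)) /\ B = A) \/
         (~ consistent (add A (stage T n)) /\
          exists C, A = fAll C /\ B = fNot (inst (S n) C)))
  end.

Definition henkin (T : form -> Prop) (A : form) : Prop := exists n, stage T n A.

Section Henkin.
Context (T : form -> Prop) (T_closed : forall A, T A -> bounded 0 A)
  (T_consistent : consistent T).

Lemma stage_le n m A : n <= m -> stage T n A -> stage T m A.
Proof. induction 1; cbn; auto. Qed.

Lemma stage_bounded n : forall A, stage T n A -> bounded (S n) A.
Proof.
  induction n as [|n IH]; cbn.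
  - intros A HA. apply bounded_le with 0; auto.
  - intros B [HB|(A & <- & [[_ ->]|[_ (C & -> & ->)]])].
    + apply bounded_le with (S n); auto.
    + apply bounded_le with (S (code A)); auto using bounded_code.
    + pose proof (bounded_code (fAll C)) as HC. cbn [bounded] in HC.
      split; [|exact I]. eapply bounded_rename; [exact HC|].
      intros [|k] Hk; lia.
Qed.

(** Only naming a counterexample to [fAll C] needs an argument: were it inconsistent, the
    previous stage would prove [C] at a fresh variable, hence [fAll C], which it refutes. *)
Lemma stage_consistent n : consistent (stage T n).
Proof.
  induction n as [|n IH]; [exact T_consistent|]. intros HS.
  destruct (classic (exists A, code A = n)) as [(A & HA)|Hno].
  2:{ apply IH. eapply provable_mono; [|exact HS].
      intros B [HB|(A & HA & _)]; auto. exfalso; eauto. }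
  destruct (classic (consistent (add A (stage T n)))) as [Hc|Hc].
  - apply Hc. eapply provable_mono; [|exact HS].
    intros B [HB|(A' & HA' & [[_ ->]|[Hn _]])]; [now right|left|exfalso].
    + apply code_inj; congruence.
    + assert (A' = A) as -> by (apply code_inj; congruence). auto.
  - assert (Hin : provable (add A (stage T n)) fBot) by now apply NNPP.
    apply provable_impI in Hin.
    destruct (classic (exists C, A = fAll C)) as [(C & ->)|HC].
    + apply IH. apply provable_impE with (1 := Hin).
      apply provable_generalize with (S n).
      * apply stage_bounded.
      * pose proof (bounded_code (fAll C)) as HC. now rewrite HA in HC.
      * apply provable_raa. eapply provable_mono; [|exact HS].
        intros B [HB|(A' & HA' & HB)]; [now right|].
        assert (A' = fAll C) as -> by (apply code_inj; congruence).
        destruct HB as [[Hn _]|[_ (C' & [= <-] & ->)]]; [now elim Hc|now left].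
    + apply IH. eapply provable_mono; [|exact HS].
      intros B [HB|(A' & HA' & HB)]; auto.
      assert (A' = A) as -> by (apply code_inj; congruence).
      destruct HB as [[Hn _]|[_ (C' & -> & _)]]; [now elim Hc|]. exfalso; eauto.
Qed.

Lemma henkin_consistent : consistent (henkin T).
Proof.
  intros (G & HG & H).
  assert (exists n, forall B, In B G -> stage T n B) as [n Hn].
  { clear H. induction G as [|B G IH].
    - exists 0. intros ? [].
    - destruct IH as [n Hn]; [intros; apply HG; cbn; auto|].
      destruct (HG B) as [m Hm]; [cbn; auto|].
      exists (max n m). intros C [<-|HC].
      + eapply stage_le; [|exact Hm]; lia.
      + eapply stage_le; [|apply Hn, HC]; lia. }
  apply (stage_consistent n). exists G; auto.
Qed.

Lemma henkin_maximal A : consistent (add A (henkin T)) -> henkin T A.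
Proof.
  intros H. exists (S (code A)). cbn. right. exists A. split; auto. left. split; auto.
  intros H'. apply H. eapply provable_mono; [|exact H'].
  intros B [->|HB]; [now left|right; now exists (code A)].
Qed.

Lemma henkin_closed A : provable (henkin T) A -> henkin T A.
Proof.
  intros H. apply henkin_maximal. intros H'. apply henkin_consistent.
  apply provable_impI in H'. eapply provable_impE; eauto.
Qed.

Lemma henkin_imp A B : henkin T (fImp A B) <-> (henkin T A -> henkin T B).
Proof.
  split.
  - intros H HA. apply henkin_closed.
    eapply provable_impE; apply provable_ax; eassumption.
  - intros H. apply henkin_closed. destruct (classic (henkin T A)) as [HA|HA].
    + apply provable_impI, provable_ax. right; auto.
    + apply provable_impI. apply provable_raa.
      apply provable_mono with (add A (henkin T)); [intros C; now right|].
      apply NNPP. intros Hc. apply HA, henkin_maximal, Hc.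
Qed.

Lemma henkin_all A : henkin T (fAll A) <-> forall t, henkin T (inst t A).
Proof.
  split.
  - intros H t. now apply henkin_closed, provable_allE, provable_ax.
  - intros H. apply NNPP. intros Hn.
    assert (Hw : henkin T (fNot (inst (S (code (fAll A))) A))).
    { exists (S (code (fAll A))). right. exists (fAll A). split; auto. right.
      split; [|eauto]. intros Hc. apply Hn.
      exists (S (code (fAll A))). right. exists (fAll A). split; auto. }
    apply henkin_consistent. eapply provable_impE; apply provable_ax; [exact Hw|auto].
Qed.

Lemma henkin_leibniz A x y :
  henkin T (fEq x y) -> henkin T (inst x A) -> henkin T (inst y A).
Proof.
  intros H1 H2. apply henkin_closed.
  apply provable_leibniz with x; now apply provable_ax.
Qed.

Lemma henkin_eq_refl x : henkin T (fEq x x).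
Proof. apply henkin_closed. exists []. split; [intros ? []|apply d_refl]. Qed.

(** Here and in the next two lemmas, index [0] of the formula passed to [henkin_leibniz] marks
    the place to be rewritten, and variables of the ambient context appear shifted. *)
Lemma henkin_eq_sym x y : henkin T (fEq x y) -> henkin T (fEq y x).
Proof.
  intros H. apply (henkin_leibniz (fEq 0 (S x)) x y H), henkin_eq_refl.
Qed.

Lemma henkin_eq_trans x y z :
  henkin T (fEq x y) -> henkin T (fEq y z) -> henkin T (fEq x z).
Proof. intros H1 H2. exact (henkin_leibniz (fEq (S x) 0) y z H2 H1). Qed.

Lemma henkin_mem x y x' y' :
  henkin T (fEq x x') -> henkin T (fEq y y') ->
  henkin T (fMem x y) -> henkin T (fMem x' y').
Proof.
  intros Hx Hy H. apply (henkin_leibniz (fMem (S x') 0) y y' Hy).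
  exact (henkin_leibniz (fMem 0 (S y)) x x' Hx H).
Qed.

End Henkin.

(** * Structures and completeness *)

Fixpoint sat {D : Type} (E : D -> D -> Prop) (e : nat -> D) (A : form) : Prop :=
  match A with
  | fBot => False
  | fMem x y => E (e x) (e y)
  | fEq x y => e x = e y
  | fImp A B => sat E e A -> sat E e B
  | fAll A => forall d, sat E (d .: e) A
  end.

Lemma sat_rename {D} (E : D -> D -> Prop) A : forall r e e',
  (forall n, e' n = e (r n)) -> sat E e (rename r A) <-> sat E e' A.
Proof.
  induction A as [|x y|x y|A IHA B IHB|A IHA]; intros r e e' H; cbn.
  - reflexivity.
  - now rewrite !H.
  - now rewrite !H.
  - now rewrite (IHA r e e' H), (IHB r e e' H).
  - split; intros HA d; specialize (HA d);
      apply (IHA (up r) (d .: e) (d .: e')); auto; intros [|n]; cbn; auto.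
Qed.

Lemma sat_bounded {D} (E : D -> D -> Prop) A : forall n e e',
  bounded n A -> (forall k, k < n -> e k = e' k) -> sat E e A <-> sat E e' A.
Proof.
  induction A as [|x y|x y|A IHA B IHB|A IHA]; intros n e e' HA H; cbn in *.
  - reflexivity.
  - now rewrite !H.
  - now rewrite !H.
  - destruct HA. now rewrite (IHA n e e'), (IHB n e e').
  - split; intros Hd d; specialize (Hd d);
      apply (IHA (S n) (d .: e) (d .: e')); auto;
      intros [|k] Hk; cbn; auto; apply H; lia.
Qed.

(** The structure consists of the classes of variables under equality in the Henkin theory,
    represented by their characteristic predicates so that the equality of classes is
    Leibniz equality. The environment [e0] witnesses that the domain is inhabited. *)
Lemma model_existence (T : form -> Prop) :
  (forall A, T A -> bounded 0 A) -> consistent T ->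
  exists (D : Type) (E : D -> D -> Prop) (e0 : nat -> D),
    forall A, T A -> forall e, sat E e A.
Proof.
  intros Hcl Hcon.
  pose (M := henkin T).
  pose (D := {P : nat -> Prop | exists n, P = fun m => M (fEq n m)}).
  pose (cls := fun n : nat =>
    exist (fun P => exists n, P = fun m => M (fEq n m)) (fun m => M (fEq n m))
      (ex_intro _ n eq_refl) : D).
  assert (cls_eq : forall n m, cls n = cls m <-> M (fEq n m)).
  { intros n m. split.
    - intros H. apply (f_equal (fun d : D => proj1_sig d m)) in H. cbn in H.
      rewrite H. now apply henkin_eq_refl.
    - intros H. apply subset_eq_compat.
      apply functional_extensionality. intros k. apply propositional_extensionality.
      split; intros Hk; eapply henkin_eq_trans; eauto. now apply henkin_eq_sym. }
  assert (cls_surj : forall d : D, exists n, d = cls n).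
  { intros [P [n ->]]. exists n. now apply subset_eq_compat. }
  pose (E := fun d d' : D => exists n m, d = cls n /\ d' = cls m /\ M (fMem n m)).
  (* The renaming [r] chooses representatives of the values of [e]; passing under a quantifier
     chooses one for the new value. *)
  assert (truth : forall A r e, (forall n, e n = cls (r n)) ->
    (sat E e A <-> M (rename r A))).
  { induction A as [|x y|x y|A IHA B IHB|A IHA]; intros r e He; cbn.
    - split; [easy|]. intros H. eapply henkin_consistent; eauto.
      now apply provable_ax.
    - rewrite !He. split.
      + intros (n & m & H1 & H2 & H).
        apply henkin_mem with n m; auto; apply cls_eq; auto.
      + intros H. exists (r x), (r y). auto.
    - rewrite !He. apply cls_eq.
    - rewrite (IHA r e He), (IHB r e He). symmetry. now apply henkin_imp.
    - etransitivity; [|symmetry; now apply henkin_all].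
      assert (Hi : forall t, inst t (rename (up r) A) = rename (t .: r) A).
      { intros t. unfold inst. rewrite rename_rename. apply rename_ext.
        now intros [|n]. }
      split.
      + intros H t. rewrite Hi. apply (IHA (t .: r) (cls t .: e)); [|apply H].
        intros [|n]; cbn; auto.
      + intros H d. destruct (cls_surj d) as [t ->].
        apply (IHA (t .: r)); [intros [|n]; cbn; auto|]. rewrite <- Hi. apply H. }
  exists D, E, cls. intros A HA e.
  apply (sat_bounded E A 0 e cls); [auto|intros; lia|].
  apply (truth A (fun n => n)); auto. rewrite rename_id. now exists 0.
Qed.

Theorem completeness (T : form -> Prop) (A : form) :
  (forall B, T B -> bounded 0 B) -> bounded 0 A ->
  (forall (D : Type) (E : D -> D -> Prop),
    (forall B, T B -> forall e, sat E e B) -> forall e, sat E e A) ->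
  provable T A.
Proof.
  intros HT HA H. apply provable_raa. apply NNPP. intros Hc.
  destruct (model_existence (add (fNot A) T)) as (D & E & e0 & Hm); auto.
  - intros B [->|HB]; cbn; auto.
  - apply (Hm (fNot A) (or_introl eq_refl) e0).
    apply H. intros B HB. apply Hm. now right.
Qed.
Local Open Scope fol_scope.

Section Connectives.
Context {D : Type} (E : D -> D -> Prop).

Lemma sat_not e A : sat E e (∼ A) <-> ~ sat E e A.
Proof. reflexivity. Qed.

Lemma sat_and e A B : sat E e (A ⋀ B) <-> sat E e A /\ sat E e B.
Proof. cbn; tauto. Qed.

Lemma sat_or e A B : sat E e (A ⋁ B) <-> sat E e A \/ sat E e B.
Proof. cbn; tauto. Qed.

Lemma sat_imp e A B : sat E e (A ⟶ B) <-> (sat E e A -> sat E e B).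
Proof. reflexivity. Qed.

Lemma sat_iff e A B : sat E e (A ⟷ B) <-> (sat E e A <-> sat E e B).
Proof. cbn; tauto. Qed.

Lemma sat_all e A : sat E e (fAll A) <-> forall d, sat E (d .: e) A.
Proof. reflexivity. Qed.

Lemma sat_ex e A : sat E e (fEx A) <-> exists d, sat E (d .: e) A.
Proof.
  cbn. split.
  - intros H. apply NNPP. intros Hn. apply H. intros d Hd. eauto.
  - intros [d Hd] H. now apply (H d).
Qed.

Lemma sat_not_iff e A P : (sat E e A <-> P) -> (sat E e (∼ A) <-> ~ P).
Proof. rewrite sat_not; tauto. Qed.

Lemma sat_and_iff e A B P Q :
  (sat E e A <-> P) -> (sat E e B <-> Q) -> (sat E e (A ⋀ B) <-> P /\ Q).
Proof. rewrite sat_and; tauto. Qed.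

Lemma sat_or_iff e A B P Q :
  (sat E e A <-> P) -> (sat E e B <-> Q) -> (sat E e (A ⋁ B) <-> P \/ Q).
Proof. rewrite sat_or; tauto. Qed.

Lemma sat_imp_iff e A B P Q :
  (sat E e A <-> P) -> (sat E e B <-> Q) -> (sat E e (A ⟶ B) <-> (P -> Q)).
Proof. rewrite sat_imp; tauto. Qed.

Lemma sat_iff_iff e A B P Q :
  (sat E e A <-> P) -> (sat E e B <-> Q) -> (sat E e (A ⟷ B) <-> (P <-> Q)).
Proof. rewrite sat_iff; tauto. Qed.

Lemma sat_all_iff e A (P : D -> Prop) :
  (forall d, sat E (d .: e) A <-> P d) -> (sat E e (fAll A) <-> forall d, P d).
Proof. rewrite sat_all. intros H. now setoid_rewrite H. Qed.

Lemma sat_ex_iff e A (P : D -> Prop) :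
  (forall d, sat E (d .: e) A <-> P d) -> (sat E e (fEx A) <-> exists d, P d).
Proof. rewrite sat_ex. intros H. now setoid_rewrite H. Qed.

Lemma sat_fAlls n : forall e A,
  sat E e (fAlls n A) -> forall e', (forall k, e' (n + k) = e k) -> sat E e' A.
Proof.
  induction n as [|n IH]; intros e A H e' He'; cbn in H.
  - apply (sat_rename E A (fun k => k) e) in He' as Hr.
    rewrite rename_id in Hr. now apply Hr.
  - apply IH with (e' := fun k => e' (S k)) in H.
    + specialize (H (e' 0)).
      rewrite <- (rename_id A) in H. apply (sat_rename E A) with (e' := e') in H; auto.
      now intros [|k].
    + intros k. apply (He' k).
Qed.

End Connectives.

(** Proves that a formula means its set-theoretic reading by following the syntax of the
    formula; [leaf] rewrites with the meanings of the abbreviations it is built from. *)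
Ltac sat_structure leaf :=
  lazymatch goal with
  | |- sat _ _ (fEx _) <-> _ => apply sat_ex_iff; intro; sat_structure leaf
  | |- sat _ _ (fAll _) <-> _ => apply sat_all_iff; intro; sat_structure leaf
  | |- sat _ _ (fAnd _ _) <-> _ => apply sat_and_iff; sat_structure leaf
  | |- sat _ _ (fOr _ _) <-> _ => apply sat_or_iff; sat_structure leaf
  | |- sat _ _ (fIff _ _) <-> _ => apply sat_iff_iff; sat_structure leaf
  | |- sat _ _ (fNot _) <-> _ => apply sat_not_iff; sat_structure leaf
  | |- sat _ _ (fImp _ _) <-> _ => apply sat_imp_iff; sat_structure leaf
  | _ => first [leaf; reflexivity | reflexivity]
  end.

(** * Set-theoretic vocabulary in a structure *)

Section Vocabulary.
Context {D : Type} (E : D -> D -> Prop).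
Notation "x 'ε' y" := (E x y) (at level 70, no associativity).

Definition Empty x := forall z, ~ z ε x.
Definition Subset x y := forall z, z ε x -> z ε y.
Definition Pair c a b := forall z, z ε c <-> z = a \/ z = b.
Definition OPair p a b := forall z, z ε p <-> Pair z a a \/ Pair z a b.
Definition PIn a b f := exists p, OPair p a b /\ p ε f.
Definition Succ s a := forall z, z ε s <-> z ε a \/ z = a.
Definition Inductive_set w :=
  (exists z, Empty z /\ z ε w) /\ forall a, a ε w -> exists s, Succ s a /\ s ε w.
Definition Omega w := Inductive_set w /\ forall v, Inductive_set v -> Subset w v.
Definition Func f x y :=
  (forall p, p ε f -> exists a b, a ε x /\ b ε y /\ OPair p a b) /\
  (forall a, a ε x -> exists b, PIn a b f) /\
  (forall a b c, PIn a b f /\ PIn a c f -> b = c).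
Definition Inj f x y :=
  Func f x y /\ forall a a' b, PIn a b f /\ PIn a' b f -> a = a'.
Definition Bij f x y := Inj f x y /\ forall b, b ε y -> exists a, PIn a b f.
Definition Equipotent x y := exists f, Bij f x y.
Definition Countable x := exists w, Omega w /\ Equipotent x w.
Definition CardinalInfinite x := exists w, Omega w /\ exists f, Inj f w x.
Definition CantorInfinite x := exists y, Subset y x /\ Countable y.
Definition DedekindInfinite x := exists y, Subset y x /\ y <> x /\ Equipotent y x.

Lemma sat_is_empty e x :
  sat E e (is_empty x) <-> Empty (e x).
Proof. unfold is_empty; sat_structure ltac:(fail). Qed.

Lemma sat_is_subset e x y :
  sat E e (is_subset x y) <-> Subset (e x) (e y).
Proof. unfold is_subset; sat_structure ltac:(fail). Qed.

Lemma sat_is_pair e c a b :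
  sat E e (is_pair c a b) <-> Pair (e c) (e a) (e b).
Proof. unfold is_pair; sat_structure ltac:(fail). Qed.

Lemma sat_is_opair e p a b :
  sat E e (is_opair p a b) <-> OPair (e p) (e a) (e b).
Proof. unfold is_opair; sat_structure ltac:(rewrite sat_is_pair). Qed.

Lemma sat_opair_in e a b f :
  sat E e (opair_in a b f) <-> PIn (e a) (e b) (e f).
Proof. unfold opair_in; sat_structure ltac:(rewrite sat_is_opair). Qed.

Lemma sat_is_succ e s a :
  sat E e (is_succ s a) <-> Succ (e s) (e a).
Proof. unfold is_succ; sat_structure ltac:(fail). Qed.

Lemma sat_is_inductive e w :
  sat E e (is_inductive w) <-> Inductive_set (e w).
Proof. unfold is_inductive; sat_structure ltac:(first [rewrite sat_is_empty | rewrite sat_is_succ]). Qed.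

Lemma sat_is_omega e w :
  sat E e (is_omega w) <-> Omega (e w).
Proof. unfold is_omega; sat_structure ltac:(first [rewrite sat_is_inductive | rewrite sat_is_subset]). Qed.

Lemma sat_is_function e f x y :
  sat E e (is_function f x y) <-> Func (e f) (e x) (e y).
Proof. unfold is_function; sat_structure ltac:(first [rewrite sat_opair_in | rewrite sat_is_opair]). Qed.

Lemma sat_is_injection e f x y :
  sat E e (is_injection f x y) <-> Inj (e f) (e x) (e y).
Proof. unfold is_injection; sat_structure ltac:(first [rewrite sat_is_function | rewrite sat_opair_in]). Qed.

Lemma sat_is_bijection e f x y :
  sat E e (is_bijection f x y) <-> Bij (e f) (e x) (e y).
Proof. unfold is_bijection; sat_structure ltac:(first [rewrite sat_is_injection | rewrite sat_opair_in]). Qed.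

Lemma sat_equipotent e x y :
  sat E e (equipotent x y) <-> Equipotent (e x) (e y).
Proof. unfold equipotent; sat_structure ltac:(rewrite sat_is_bijection). Qed.

Lemma sat_countable e x :
  sat E e (countable x) <-> Countable (e x).
Proof. unfold countable; sat_structure ltac:(first [rewrite sat_is_omega | rewrite sat_equipotent]). Qed.

Lemma sat_cardinal_infinite e x :
  sat E e (cardinal_infinite x) <-> CardinalInfinite (e x).
Proof. unfold cardinal_infinite; sat_structure ltac:(first [rewrite sat_is_omega | rewrite sat_is_injection]). Qed.

Lemma sat_cantor_infinite e x :
  sat E e (cantor_infinite x) <-> CantorInfinite (e x).
Proof. unfold cantor_infinite; sat_structure ltac:(first [rewrite sat_is_subset | rewrite sat_countable]). Qed.

Lemma sat_dedekind_infinite e x :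
  sat E e (dedekind_infinite x) <-> DedekindInfinite (e x).
Proof. unfold dedekind_infinite; sat_structure ltac:(first [rewrite sat_is_subset | rewrite sat_equipotent]). Qed.

(** * Predicates definable by formulas *)

(** The positions of [e] below those bound by quantifiers hold the parameters, so that
    [fun x => P (x .: e)] is a predicate definable from the parameters [e]. *)
Definition Definable (P : (nat -> D) -> Prop) : Prop :=
  exists A, forall e, sat E e A <-> P e.

Lemma def_mem i j : Definable (fun e => e i ε e j).
Proof. exists (i ∈ j). reflexivity. Qed.
Lemma def_eq i j : Definable (fun e => e i = e j).
Proof. exists (i ≡ j). reflexivity. Qed.
Lemma def_empty i : Definable (fun e => Empty (e i)).
Proof. exists (is_empty i). intros; apply sat_is_empty. Qed.
Lemma def_opair i j k : Definable (fun e => OPair (e i) (e j) (e k)).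
Proof. exists (is_opair i j k). intros; apply sat_is_opair. Qed.
Lemma def_pin i j k : Definable (fun e => PIn (e i) (e j) (e k)).
Proof. exists (opair_in i j k). intros; apply sat_opair_in. Qed.
Lemma def_succ i j : Definable (fun e => Succ (e i) (e j)).
Proof. exists (is_succ i j). intros; apply sat_is_succ. Qed.
Lemma def_inductive i : Definable (fun e => Inductive_set (e i)).
Proof. exists (is_inductive i). intros; apply sat_is_inductive. Qed.

Lemma def_not P : Definable P -> Definable (fun e => ~ P e).
Proof. intros [A HA]. exists (∼ A). intros e. now rewrite sat_not, HA. Qed.
Lemma def_and P Q : Definable P -> Definable Q -> Definable (fun e => P e /\ Q e).
Proof. intros [A HA] [B HB]. exists (A ⋀ B). intros e. now rewrite sat_and, HA, HB. Qed.
Lemma def_or P Q : Definable P -> Definable Q -> Definable (fun e => P e \/ Q e).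
Proof. intros [A HA] [B HB]. exists (A ⋁ B). intros e. now rewrite sat_or, HA, HB. Qed.
Lemma def_imp P Q : Definable P -> Definable Q -> Definable (fun e => P e -> Q e).
Proof. intros [A HA] [B HB]. exists (A ⟶ B). intros e. now rewrite sat_imp, HA, HB. Qed.
(** Stated with [P] taking the bound value separately, so that unification finds [P] for any
    predicate written with an ordinary quantifier; the premise then reads the bound value and
    the old environment off a single environment again. *)
Lemma def_all (P : D -> (nat -> D) -> Prop) :
  Definable (fun e => P (e 0) (fun n => e (S n))) -> Definable (fun e => forall x, P x e).
Proof.
  intros [A HA]. exists (fAll A). intros e. rewrite sat_all.
  now setoid_rewrite HA.
Qed.
Lemma def_ex (P : D -> (nat -> D) -> Prop) :
  Definable (fun e => P (e 0) (fun n => e (S n))) -> Definable (fun e => exists x, P x e).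
Proof.
  intros [A HA]. exists (fEx A). intros e. rewrite sat_ex.
  now setoid_rewrite HA.
Qed.

End Vocabulary.


Ltac definable :=
  repeat (cbv beta; first
    [ apply def_mem | apply def_eq | apply def_empty | apply def_opair | apply def_pin
    | apply def_succ | apply def_inductive | apply def_not | apply def_and | apply def_or
    | apply def_imp | apply def_all | apply def_ex ]).

(** * Sets, pairs and relations in a model of Z *)

Section ModelOfZ.
Context {D : Type} (E : D -> D -> Prop) (HZ : forall A, Z A -> forall e, sat E e A).
Notation "x 'ε' y" := (E x y) (at level 70, no associativity).

Lemma extensionality x y : (forall z, z ε x <-> z ε y) -> x = y.
Proof.
  enough (H : sat E (fun _ => x) ax_extensionality <->
    forall x y, (forall z, z ε x <-> z ε y) -> x = y).
  { apply H, HZ, Z_extensionality. }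
  unfold ax_extensionality; sat_structure fail.
Qed.

Lemma pair_ex a b : exists c, Pair E c a b.
Proof.
  enough (H : sat E (fun _ => a) ax_pair <-> forall a b, exists c, Pair E c a b).
  { apply H, HZ, Z_pair. }
  unfold ax_pair; sat_structure ltac:(rewrite sat_is_pair).
Qed.

Lemma big_union_ex a : exists u, forall z, z ε u <-> exists y, y ε a /\ z ε y.
Proof.
  enough (H : sat E (fun _ => a) ax_union <->
    forall a, exists u, forall z, z ε u <-> exists y, y ε a /\ z ε y).
  { apply H, HZ, Z_union. }
  unfold ax_union; sat_structure fail.
Qed.

Lemma power_ex a : exists p, forall z, z ε p <-> Subset E z a.
Proof.
  enough (H : sat E (fun _ => a) ax_power <->
    forall a, exists p, forall z, z ε p <-> Subset E z a).
  { apply H, HZ, Z_power. }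
  unfold ax_power; sat_structure ltac:(rewrite sat_is_subset).
Qed.

Lemma inductive_ex (x : D) : exists w, Inductive_set E w.
Proof.
  enough (H : sat E (fun _ => x) ax_infinity <-> exists w, Inductive_set E w).
  { apply H, HZ, Z_infinity. }
  unfold ax_infinity; sat_structure ltac:(rewrite sat_is_inductive).
Qed.

(** The comprehension axiom is a closed sentence with a fixed number of quantified parameters.
    The code of [A] bounds its variables, so that many parameters suffice, and they can be
    given the values in any environment [e]. *)
Lemma separation P (HP : Definable E P) (e : nat -> D) a :
  exists b, forall z, z ε b <-> z ε a /\ P (z .: e).
Proof.
  destruct HP as [A HA].
  pose proof (HZ _ (Z_comprehension (code A) A (bounded_code A))) as Hax.
  specialize (Hax (fun k => e (code A + k))).
  apply sat_fAlls with (e' := e) in Hax; [|reflexivity].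
  setoid_rewrite sat_all in Hax. specialize (Hax a).
  setoid_rewrite sat_ex in Hax. destruct Hax as [b Hb]. exists b. intros z.
  specialize (Hb z). rewrite sat_iff, sat_and in Hb.
  rewrite sat_rename with (e' := z .: e), HA in Hb; [exact Hb|].
  now intros [|n].
Qed.

Lemma union_ex x y : exists u, forall z, z ε u <-> z ε x \/ z ε y.
Proof.
  destruct (pair_ex x y) as [c Hc]. destruct (big_union_ex c) as [u Hu].
  exists u. intros z. rewrite Hu. unfold Pair in Hc. setoid_rewrite Hc. split.
  - intros (t & [->| ->] & Ht); auto.
  - intros [H|H]; eauto.
Qed.

Lemma succ_ex a : exists s, Succ E s a.
Proof.
  destruct (pair_ex a a) as [c Hc]. destruct (union_ex a c) as [s Hs].
  exists s. intros z. rewrite (Hs z), (Hc z). tauto.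
Qed.

Lemma opair_ex a b : exists p, OPair E p a b.
Proof.
  destruct (pair_ex a a) as [c Hc], (pair_ex a b) as [d Hd], (pair_ex c d) as [p Hp].
  exists p. intros z. rewrite (Hp z).
  split; intros [H|H]; subst; auto; [left|right];
    apply extensionality; intros t; [now rewrite (H t), (Hc t)|now rewrite (H t), (Hd t)].
Qed.

Lemma pair_inj c a b a' b' :
  Pair E c a b -> Pair E c a' b' -> (a = a' /\ b = b') \/ (a = b' /\ b = a').
Proof.
  intros H H'.
  assert (Hi : forall z, z = a \/ z = b <-> z = a' \/ z = b').
  { intros z. now rewrite <- (H z), <- (H' z). }
  destruct (proj1 (Hi a) (or_introl eq_refl)), (proj1 (Hi b) (or_intror eq_refl)),
    (proj2 (Hi a') (or_introl eq_refl)), (proj2 (Hi b') (or_intror eq_refl));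
    subst; auto.
Qed.

Lemma opair_inj p a b a' b' : OPair E p a b -> OPair E p a' b' -> a = a' /\ b = b'.
Proof.
  intros H H'.
  destruct (pair_ex a a) as [c Hc], (pair_ex a b) as [d Hd],
    (pair_ex a' b') as [d' Hd'].
  assert (Hcp : c ε p) by (apply H; auto). assert (Hdp : d ε p) by (apply H; auto).
  assert (Hdp' : d' ε p) by (apply H'; auto).
  assert (a = a') as <-.
  { apply H' in Hcp as [Hq|Hq]; destruct (pair_inj _ _ _ _ _ Hc Hq) as [[]|[]]; congruence. }
  split; auto.
  apply H' in Hdp as [Hq|Hq]; apply H in Hdp' as [Hq'|Hq'];
    destruct (pair_inj _ _ _ _ _ Hd Hq) as [[]|[]];
    destruct (pair_inj _ _ _ _ _ Hd' Hq') as [[]|[]]; congruence.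
Qed.

(** A definable relation between [x] and [y] is a set, carved out of the double power set of
    the union of [x] and [y], where the Kuratowski pairs live. *)
Lemma relation_ex P (HP : Definable E P) (e : nat -> D) x y :
  exists f,
    (forall p, p ε f -> exists a b, a ε x /\ b ε y /\ OPair E p a b) /\
    (forall a b, PIn E a b f <-> a ε x /\ b ε y /\ P (a .: b .: e)).
Proof.
  destruct (union_ex x y) as [u Hu], (power_ex u) as [v Hv], (power_ex v) as [t Ht].
  assert (HQ : Definable E (fun e' => exists a b, a ε e' 1 /\ b ε e' 2 /\
    OPair E (e' 0) a b /\ P (a .: b .: (fun n => e' (3 + n))))).
  { do 2 apply def_ex. cbv beta. repeat apply def_and; try definable.
    destruct HP as [A HA].
    (* Under the quantifiers over [a] and [b], index 0 is [b], index 1 is [a], and the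
       parameters of [P] come after [b], [a], the pair, [x] and [y]. *)
    exists (rename (1 .: 0 .: (fun n => 5 + n)) A). intros e'.
    rewrite <- HA. apply sat_rename. now intros [|[|n]]. }
  destruct (separation _ HQ (x .: y .: e) t) as [f Hf]. cbn in Hf. exists f. split.
  - intros p Hp. apply Hf in Hp as (_ & a & b & Ha & Hb & Hp & _). eauto.
  - intros a b. split.
    + intros (p & Hp & Hpf).
      apply Hf in Hpf as (_ & a' & b' & Ha & Hb & Hp' & HPab).
      destruct (opair_inj _ _ _ _ _ Hp Hp') as [-> ->]. auto.
    + intros (Ha & Hb & HPab). destruct (opair_ex a b) as [p Hp]. exists p.
      split; auto. apply Hf. split; [|exists a, b; auto].
      apply Ht. intros q Hq. apply Hv. intros r Hr. apply Hu.
      apply Hp in Hq as [Hq|Hq]; apply Hq in Hr as [->| ->]; auto.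
Qed.

(** * Natural numbers in a model of Z *)

Lemma empty_unique z z' : Empty E z -> Empty E z' -> z = z'.
Proof.
  intros H H'. apply extensionality. intros t. split; intros Ht.
  - now apply H in Ht.
  - now apply H' in Ht.
Qed.

Lemma succ_unique s s' a : Succ E s a -> Succ E s' a -> s = s'.
Proof. intros H H'. apply extensionality. intros t. now rewrite (H t), (H' t). Qed.

Lemma succ_not_empty s a : Succ E s a -> ~ Empty E s.
Proof. intros H He. apply (He a), H. now right. Qed.

(** The least inductive set is cut out of any inductive set by comprehension. The argument
    [x] only serves to inhabit the domain. *)
Lemma omega_ex (x : D) : exists w, Omega E w.
Proof.
  destruct (inductive_ex x) as [v Hv].
  destruct (separation (fun e => forall u, Inductive_set E u -> e 0 ε u)
    ltac:(definable) (fun _ => x) v) as [w Hw]. cbn in Hw.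
  exists w. split; [split|].
  - destruct (proj1 Hv) as (z & Hz & Hzv). exists z. split; auto.
    apply Hw. split; auto. intros u [(z' & Hz' & Hzu) _].
    now rewrite (empty_unique _ _ Hz Hz').
  - intros a Ha. destruct (succ_ex a) as [s Hs]. exists s. split; auto.
    apply Hw in Ha as [Hav Ha]. apply Hw. split.
    + destruct (proj2 Hv a Hav) as (s' & Hs' & H). now rewrite (succ_unique _ _ _ Hs Hs').
    + intros u Hu. destruct (proj2 Hu a (Ha u Hu)) as (s' & Hs' & H).
      now rewrite (succ_unique _ _ _ Hs Hs').
  - intros u Hu a Ha. apply Hw in Ha as [_ Ha]. auto.
Qed.

Section Omega.
Context (w : D) (Hw : Omega E w).

Lemma zero_in z : Empty E z -> z ε w.
Proof.
  intros Hz. destruct Hw as [[(z' & Hz' & H) _] _]. now rewrite (empty_unique _ _ Hz Hz').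
Qed.

Lemma succ_in s n : Succ E s n -> n ε w -> s ε w.
Proof.
  intros Hs Hn. destruct Hw as [[_ H] _]. destruct (H n Hn) as (s' & Hs' & Hs'w).
  now rewrite (succ_unique _ _ _ Hs Hs').
Qed.

Lemma omega_ind P (HP : Definable E P) (e : nat -> D) :
  (forall z, Empty E z -> P (z .: e)) ->
  (forall n s, n ε w -> P (n .: e) -> Succ E s n -> P (s .: e)) ->
  forall n, n ε w -> P (n .: e).
Proof.
  intros H0 HS. destruct (separation P HP e w) as [v Hv].
  assert (Hi : Inductive_set E v).
  { split.
    - destruct (proj1 (proj1 Hw)) as (z & Hz & Hzw). exists z. split; auto.
      apply Hv; auto.
    - intros n Hn. destruct (succ_ex n) as [s Hs]. exists s. split; auto.
      apply Hv in Hn as [Hn HPn]. apply Hv. split; eauto using succ_in. }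
  intros n Hn. apply Hv, (proj2 Hw v Hi n Hn).
Qed.

Lemma nat_transitive n : n ε w -> forall m k, m ε n -> k ε m -> k ε n.
Proof.
  revert n. refine (omega_ind (fun e => forall m k, m ε e 0 -> k ε m -> k ε e 0)
    ltac:(definable) (fun _ => w) _ _); cbn.
  - intros z Hz m k Hm. now apply Hz in Hm.
  - intros n s _ IH Hs m k Hm Hk. apply Hs. left. apply Hs in Hm as [Hm| ->]; eauto.
Qed.

(** Without Foundation this has to be proved by induction, from the transitivity of natural
    numbers; it is what makes the successor injective. *)
Lemma nat_irreflexive n : n ε w -> ~ n ε n.
Proof.
  intros Hn. enough (n ε w /\ ~ n ε n) by tauto. revert n Hn.
  refine (omega_ind (fun e => e 0 ε e 1 /\ ~ e 0 ε e 0)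
    ltac:(definable) (fun _ => w) _ _); cbn.
  - intros z Hz. split; [now apply zero_in|apply Hz].
  - intros n s _ [Hn IH] Hs. split; [now apply (succ_in s n)|]. intros Hss. apply IH.
    assert (Hns : n ε s) by (apply Hs; auto).
    apply Hs in Hss as [Hss| <-]; auto.
    now apply (nat_transitive n Hn s).
Qed.

Lemma succ_inj s n m : n ε w -> m ε w -> Succ E s n -> Succ E s m -> n = m.
Proof.
  intros Hn Hm Hsn Hsm.
  assert (H1 : n ε s) by (apply Hsn; auto). assert (H2 : m ε s) by (apply Hsm; auto).
  apply Hsm in H1 as [H1|H1]; auto. apply Hsn in H2 as [H2|H2]; auto.
  destruct (nat_irreflexive n Hn). now apply (nat_transitive n Hn m).
Qed.

Lemma nat_cases n : n ε w -> Empty E n \/ exists m, m ε w /\ Succ E n m.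
Proof.
  revert n. refine (omega_ind (fun e => Empty E (e 0) \/ exists m, m ε e 1 /\ Succ E (e 0) m)
    ltac:(definable) (fun _ => w) _ _); cbn; eauto.
Qed.

End Omega.

(** * Functions in a model of Z *)

Lemma func_dom f x y a b : Func E f x y -> PIn E a b f -> a ε x /\ b ε y.
Proof.
  intros [H _] (p & Hp & Hpf). destruct (H p Hpf) as (a' & b' & Ha & Hb & Hp').
  now destruct (opair_inj _ _ _ _ _ Hp Hp') as [-> ->].
Qed.

Lemma bij_inverse f x y : Bij E f x y -> exists g, Bij E g y x.
Proof.
  intros [[Hf Hinj] Hsurj].
  destruct (relation_ex (fun e => PIn E (e 1) (e 0) (e 2)) ltac:(definable) (fun _ => f) y x)
    as (g & Hg & Hgf). cbn in Hgf.
  exists g. split; [split; [split; [|split]|]|]; auto.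
  - intros b Hb. destruct (Hsurj b Hb) as [a Ha]. exists a. apply Hgf.
    pose proof (func_dom _ _ _ _ _ Hf Ha). tauto.
  - intros b a a' [H1 H2]. apply Hgf in H1, H2. now apply (Hinj a a' b).
  - intros b b' a [H1 H2]. apply Hgf in H1, H2. now apply (proj2 (proj2 Hf) a b b').
  - intros a Ha. destruct (proj1 (proj2 Hf) a Ha) as [b Hb]. exists b. apply Hgf.
    pose proof (func_dom _ _ _ _ _ Hf Hb). tauto.
Qed.

Lemma inj_codomain f x y z : Inj E f x y -> Subset E y z -> Inj E f x z.
Proof.
  intros [[Hf H] Hinj] Hyz. split; [split|]; auto.
  intros p Hp. destruct (Hf p Hp) as (a & b & Ha & Hb & Hab). eauto 6.
Qed.

(** * Comparing the notions of infinity *)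

Lemma cardinal_cantor x : CardinalInfinite E x -> CantorInfinite E x.
Proof.
  intros (w & Hw & f & Hf).
  destruct (separation (fun e => exists n, PIn E n (e 0) (e 1)) ltac:(definable)
    (fun _ => f) x) as [y Hy]. cbn in Hy.
  exists y. split; [intros b Hb; now apply Hy|]. exists w. split; auto.
  apply bij_inverse with f. split; [split; [split; [|split]|]|].
  - intros p Hp. destruct (proj1 (proj1 Hf) p Hp) as (a & b & Ha & Hb & Hab).
    exists a, b. split; auto. split; auto. apply Hy. split; auto. exists a, p. auto.
  - apply Hf.
  - apply Hf.
  - apply Hf.
  - intros b Hb. now apply Hy.
Qed.

Lemma cantor_cardinal x : CantorInfinite E x -> CardinalInfinite E x.
Proof.
  intros (y & Hyx & w & Hw & f & Hf). exists w. split; auto.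
  destruct (bij_inverse _ _ _ Hf) as [g [Hg _]]. exists g. now apply inj_codomain with y.
Qed.

(** The bijection [h] undoes one step along the sequence [f] and is the identity off its
    range; the value [x0] of [f] at zero has no predecessor and is the element left out. *)
Lemma cardinal_dedekind x : CardinalInfinite E x -> DedekindInfinite E x.
Proof.
  intros (w & Hw & f & [Hf Hinj]).
  assert (Hfun : forall a b c, PIn E a b f -> PIn E a c f -> b = c).
  { intros a b c H1 H2. now apply (proj2 (proj2 Hf) a b c). }
  assert (Hdom : forall a b, PIn E a b f -> a ε w).
  { intros a b H. now apply (func_dom _ _ _ _ _ Hf H). }
  destruct (proj1 (proj1 Hw)) as (z & Hz & Hzw).
  destruct (proj1 (proj2 Hf) z Hzw) as [x0 Hx0].
  pose proof (func_dom _ _ _ _ _ Hf Hx0) as [_ Hx0x].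
  destruct (separation (fun e => e 0 <> e 1) ltac:(definable) (fun _ => x0) x) as [y Hy].
  cbn in Hy.
  destruct (relation_ex (fun e =>
    (exists n s, Succ E s n /\ PIn E s (e 0) (e 2) /\ PIn E n (e 1) (e 2)) \/
    (e 0 = e 1 /\ ~ exists n, PIn E n (e 0) (e 2))) ltac:(definable) (fun _ => f) y x)
    as (h & Hh & Hhp). cbn in Hhp.
  exists y. split; [intros b Hb; now apply Hy|]. split.
  { intros ->. now apply Hy in Hx0x as [_ []]. }
  exists h. split; [split; [split; [|split]|]|]; auto.
  - intros b Hb. pose proof Hb as Hb'. apply Hy in Hb as [Hbx Hb].
    destruct (classic (exists n, PIn E n b f)) as [[s Hs]|Hno].
    + pose proof (func_dom _ _ _ _ _ Hf Hs) as [Hsw _].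
      destruct (nat_cases w Hw s Hsw) as [He|(n & Hn & Hsn)].
      * destruct Hb. rewrite (empty_unique _ _ He Hz) in Hs. eauto.
      * destruct (proj1 (proj2 Hf) n Hn) as [c Hc].
        pose proof (func_dom _ _ _ _ _ Hf Hc) as [_ Hcx].
        exists c. apply Hhp. repeat split; auto. left. eauto.
    + exists b. apply Hhp. repeat split; auto.
  - intros b c c' [H1 H2].
    apply Hhp in H1 as (_ & _ & [(n & s & Hs & Hsb & Hnc)|[-> Hno]]);
    apply Hhp in H2 as (_ & _ & [(n' & s' & Hs' & Hsb' & Hnc')|[Heq Hno']]).
    + assert (s = s') as <- by (apply (Hinj _ _ b); auto).
      assert (n = n') as <-; [|eauto].
      apply (succ_inj w Hw s); eauto.
    + destruct Hno'; eauto.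
    + destruct Hno; eauto.
    + auto.
  - intros b b' c [H1 H2].
    apply Hhp in H1 as (_ & _ & [(n & s & Hs & Hsb & Hnc)|[-> Hno]]);
    apply Hhp in H2 as (_ & _ & [(n' & s' & Hs' & Hsb' & Hnc')|[Heq Hno']]).
    + assert (n = n') as <- by (apply (Hinj _ _ c); auto).
      rewrite (succ_unique _ _ _ Hs' Hs) in Hsb'. eauto.
    + destruct Hno'. subst; eauto.
    + destruct Hno. eauto.
    + auto.
  - intros c Hc. destruct (classic (exists n, PIn E n c f)) as [[n Hn]|Hno].
    + pose proof (func_dom _ _ _ _ _ Hf Hn) as [Hnw _].
      destruct (succ_ex n) as [s Hs]. pose proof (succ_in w Hw s n Hs Hnw) as Hsw.
      destruct (proj1 (proj2 Hf) s Hsw) as [b Hb].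
      pose proof (func_dom _ _ _ _ _ Hf Hb) as [_ Hbx].
      exists b. apply Hhp. repeat split; eauto 6. apply Hy. split; auto. intros ->.
      apply (succ_not_empty _ _ Hs). now rewrite (Hinj s z x0).
    + exists c. apply Hhp. repeat split; auto. apply Hy. split; auto. intros ->. eauto.
Qed.

(** The sequence [f] with [f 0 = x0] and [h (f (n + 1)) = f n] is defined as the
    intersection of all relations closed under this recursion, inside the product of [w] and
    [x]. Minimality gives the inversion principle [Finv]: a pair of [f] is either initial or
    obtained by a step. Inversion and induction on [w] show that [f] is single-valued, since
    [h] is injective, and injective, since [h] is single-valued and [x0] is not in the
    domain of [h]. *)
Lemma dedekind_cardinal x : DedekindInfinite E x -> CardinalInfinite E x.
Proof.
  intros (y & Hyx & Hne & h & [[Hh Hinj] Hsurj]).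
  assert (Hdom : forall a b, PIn E a b h -> a ε y).
  { intros a b H. now apply (func_dom _ _ _ _ _ Hh H). }
  destruct (omega_ex x) as [w Hw]. exists w. split; auto.
  assert (exists x0, x0 ε x /\ ~ x0 ε y) as (x0 & Hx0 & Hx0y).
  { apply NNPP. intros Hn. apply Hne, extensionality. intros t. split; auto.
    intros Ht. apply NNPP. eauto. }
  destruct (relation_ex (fun e => forall r,
      (forall z, Empty E z -> PIn E z (e 2) r) /\
      (forall n a s b, PIn E n a r -> Succ E s n -> PIn E b a (e 3) -> PIn E s b r) ->
      PIn E (e 0) (e 1) r) ltac:(definable) (x0 .: fun _ => h) w x) as (f & Hf & Hfp).
  cbn in Hfp.
  assert (F0 : forall z, Empty E z -> PIn E z x0 f).
  { intros z Hz. apply Hfp. split; [now apply (zero_in w Hw)|]. split; auto.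
    intros r [Hr _]. auto. }
  assert (FS : forall n a s b, PIn E n a f -> Succ E s n -> PIn E b a h -> PIn E s b f).
  { intros n a s b Hna Hs Hba. apply Hfp in Hna as (Hn & Ha & Hna). apply Hfp.
    split; [now apply (succ_in w Hw s n)|].
    split; [now apply Hyx, (Hdom b a)|].
    intros r Hr. destruct Hr as [Hr0 HrS]. eapply HrS; eauto. }
  assert (Finv : forall n a, PIn E n a f -> (Empty E n /\ a = x0) \/
    exists m b, PIn E m b f /\ Succ E n m /\ PIn E a b h).
  { (* The pairs of [f] with this property form a relation closed under the recursion, which
       therefore includes [f]. *)
    destruct (relation_ex (fun e => PIn E (e 0) (e 1) (e 2) /\
      ((Empty E (e 0) /\ e 1 = e 3) \/
       exists m b, PIn E m b (e 2) /\ Succ E (e 0) m /\ PIn E (e 1) b (e 4)))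
      ltac:(definable) (f .: x0 .: fun _ => h) w x) as (r & _ & Hr). cbn in Hr.
    intros n a Hna. apply Hfp in Hna as (_ & _ & Hna).
    apply (Hr n a). apply Hna. split.
    - intros z Hz. apply Hr. split; [now apply (zero_in w Hw)|]. auto.
    - intros m b s c Hmb Hs Hcb. apply Hr in Hmb as (_ & _ & Hmb & _).
      assert (Hsc : PIn E s c f) by eauto.
      pose proof (proj1 (Hfp _ _) Hsc) as (H1 & H2 & _). apply Hr. eauto 10. }
  exists f. split; [split; [|split]|]; auto.
  - refine (omega_ind w Hw (fun e => exists b, PIn E (e 0) b (e 1)) ltac:(definable)
      (fun _ => f) _ _); cbn; eauto.
    intros n s Hn [a Ha] Hs. pose proof (proj1 (Hfp _ _) Ha) as (_ & Hax & _).
    destruct (Hsurj a Hax) as [b Hb]. eauto.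
  - enough (H : forall n, n ε w -> forall a b, PIn E n a f -> PIn E n b f -> a = b).
    { intros n a b [H1 H2]. pose proof (proj1 (Hfp _ _) H1) as (Hn & _). eauto. }
    refine (omega_ind w Hw (fun e => forall a b, PIn E (e 0) a (e 1) ->
      PIn E (e 0) b (e 1) -> a = b) ltac:(definable) (fun _ => f) _ _); cbn.
    + intros z Hz a b Ha Hb.
      apply Finv in Ha as [[_ ->]|(m & c & _ & Hs & _)]; [|now apply succ_not_empty in Hs].
      now apply Finv in Hb as [[_ ->]|(m & c & _ & Hs & _)]; [|apply succ_not_empty in Hs].
    + intros n s Hn IH Hs a b Ha Hb.
      apply Finv in Ha as [[He _]|(m & c & Hmc & Hsm & Hac)]; [now apply succ_not_empty in Hs|].
      apply Finv in Hb as [[He _]|(k & d & Hkd & Hsk & Hbd)]; [now apply succ_not_empty in Hs|].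
      pose proof (proj1 (Hfp _ _) Hmc) as (Hm & _).
      pose proof (proj1 (Hfp _ _) Hkd) as (Hk & _).
      rewrite (succ_inj w Hw s m n) in Hmc; auto.
      rewrite (succ_inj w Hw s k n) in Hkd; auto.
      rewrite (IH c d Hmc Hkd) in Hac. now apply (Hinj a b d).
  - enough (H : forall n, n ε w -> forall m a, PIn E n a f -> PIn E m a f -> n = m).
    { intros n m a [H1 H2]. pose proof (proj1 (Hfp _ _) H1) as (Hn & _). eauto. }
    refine (omega_ind w Hw (fun e => forall m a, PIn E (e 0) a (e 1) ->
      PIn E m a (e 1) -> e 0 = m) ltac:(definable) (fun _ => f) _ _); cbn.
    + intros z Hz m a Ha Hm.
      apply Finv in Ha as [[_ ->]|(k & c & _ & Hs & _)]; [|now apply succ_not_empty in Hs].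
      apply Finv in Hm as [[Hm _]|(k & c & _ & _ & Hc)]; [now apply empty_unique|].
      destruct Hx0y. eauto.
    + intros n s Hn IH Hs m a Ha Hm.
      apply Finv in Ha as [[He _]|(k & c & Hkc & Hsk & Hac)]; [now apply succ_not_empty in Hs|].
      pose proof (proj1 (Hfp _ _) Hkc) as (Hk & _).
      rewrite (succ_inj w Hw s k n) in Hkc; auto.
      apply Finv in Hm as [[_ ->]|(l & d & Hld & Hml & Had)].
      * destruct Hx0y. eauto.
      * assert (c = d) as <- by (apply (proj2 (proj2 Hh) a); auto).
        rewrite <- (IH l c Hkc Hld) in Hml. now apply succ_unique with n.
Qed.

End ModelOfZ.

Lemma Z_closed A : Z A -> bounded 0 A.
Proof.
  destruct 1 as [ | | | | | |n A HA]; try (cbn; lia).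
  apply bounded_fAlls. cbn. repeat split; try lia.
  all: apply (bounded_rename A (S n)); auto; intros [|k] Hk; lia.
Qed.

Theorem theorem3p5 :
  provable Z
    (fAll ((cardinal_infinite 0 ⟷ cantor_infinite 0) ⋀
           (cantor_infinite 0 ⟷ dedekind_infinite 0))).
Proof.
  apply completeness; [exact Z_closed|cbn; lia|].
  intros D E HZ e. rewrite sat_all. intros x.
  rewrite sat_and, !sat_iff, sat_cardinal_infinite, sat_cantor_infinite,
    sat_dedekind_infinite.
  pose proof (cardinal_cantor E HZ x). pose proof (cantor_cardinal E HZ x).
  pose proof (cardinal_dedekind E HZ x). pose proof (dedekind_cardinal E HZ x).
  cbn. tauto.
Qed.
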